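(* Let $C$ be a cycle of goods and $N$ a set of agents of at most two types. Then there exists a $\frac34$-sufficient allocation of the goods of $C$ to the agents in $N$.
   Context: A cycle of goods has goods $v_1,\dots,v_m$ with edges $v_iv_{i+1}$ and $v_mv_1$. A utility function assigns a non-negative real to each good, extended additively to sets. A bundle is a set of goods inducing a connected subgraph (empty allowed); an $n$-split is a sequence of $n$ pairwise disjoint bundles (possibly empty) with union all goods. $\mathrm{mms}^{(n)}(C,u)=\max_{P_1,\dots,P_n}\min_i u(P_i)$ over all $n$-splits. Agents are of the same type if they have the same utility function. An allocation to agents $1,\dots,n$ with utilities $u_1,\dots,u_n$ is an $n$-split $P_1,\dots,P_n$ with $P_i$ given to agent $i$; for $c>0$ it is $c$-sufficient if $u_i(P_i)\ge c\cdot\mathrm{mms}^{(n)}(C,u_i)$ for all $i$. *)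

(* Defs.v *)
From HB Require Import structures.
From mathcomp Require Import all_boot all_order all_algebra.
Set Implicit Arguments. Unset Strict Implicit. Unset Printing Implicit Defensive.
Import Order.TTheory GRing.Theory Num.Theory.
Local Open Scope ring_scope.

Definition cyc_adj (m : nat) : rel 'I_m :=
  fun x y => (val y == (val x).+1 %% m)%N || (val x == (val y).+1 %% m)%N.

Definition bundle (m : nat) (S : {set 'I_m}) : bool :=
  [forall x in S, forall y in S,
     connect [rel a b | [&& a \in S, b \in S & cyc_adj a b]] x y].

Definition util (R : realFieldType) (m : nat) (u : 'I_m -> R) (S : {set 'I_m}) : R :=
  \sum_(g in S) u g.

(* An n-split is encoded by the assignment f of goods to parts 0..n-1:
   parts are P_i = f^{-1}(i), pairwise disjoint with union all goods;
   it is a split iff every part is a bundle. *)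
Definition part (m n : nat) (f : {ffun 'I_m -> 'I_n}) (i : 'I_n) : {set 'I_m} :=
  [set g | f g == i].

Definition is_split (m n : nat) (f : {ffun 'I_m -> 'I_n}) : bool :=
  [forall i, bundle (part f i)].

(* min_i u(P_i). The identity element u(all goods) is an upper bound of every
   u(P_i) for non-negative u, so for n >= 1 this is exactly the minimum. *)
Definition split_min (R : realFieldType) (m n : nat) (u : 'I_m -> R)
    (f : {ffun 'I_m -> 'I_n}) : R :=
  \big[Num.min/util u [set: 'I_m]]_(i < n) util u (part f i).

(* mms^(n)(C,u) = max over n-splits of min_i u(P_i).  For n >= 1 there is
   always an n-split (everything to part 0) and values are >= 0, so using 0
   as the identity of max gives exactly the maximum. *)
Definition mms (R : realFieldType) (m n : nat) (u : 'I_m -> R) : R :=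
  \big[Num.max/0]_(f : {ffun 'I_m -> 'I_n} | is_split f) split_min u f.

Definition sufficient (R : realFieldType) (m n : nat) (U : 'I_n -> 'I_m -> R)
    (c : R) (f : {ffun 'I_m -> 'I_n}) : Prop :=
  is_split f /\ forall i : 'I_n, c * mms n (U i) <= util (U i) (part f i).

(* Main.v *)
(* Take splits A and B of the cycle that are optimal for the two utilities u
   and v; say at least half of the agents are of type u.  On a path carrying
   n consecutive A-pieces and n consecutive B-pieces, a moving knife serves all
   agents.  If some A-piece lies inside a B-piece, give it to an agent of type
   u: the remaining path still carries n-1 pieces of each kind.  The same works
   with A and B exchanged, so suppose there is no containment.  Then every
   A-cut lies inside a B-piece and divides it into two parts; if one of them is
   worth 3/4 mms(v), cut the cycle there and use the moving knife.  Otherwise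
   every such part is worth more than 1/4 mms(v), so two consecutive A-pieces,
   which together contain a whole B-piece and two further parts, are worth more
   than 3/2 mms(v).  Hence at least half of the A-pieces are worth 3/4 mms(v),
   enough for all agents of type v. *)
Require Import Defs.
From HB Require Import structures.
From mathcomp Require Import all_boot all_order all_algebra.
From mathcomp Require Import zify lra.
Import Order.TTheory GRing.Theory Num.Theory.
Set Implicit Arguments.
Unset Strict Implicit.
Unset Printing Implicit Defensive.

(** * Positions around the cycle, and arcs *)

Definition pos m (p x : 'I_m) : nat := (x + (m - p)) %% m.

(** Cutting the cycle between [ord_pred p] and [p] opens it into a path; arcs are intervals of that
    path and never wrap past the cut. *)
Definition arc m (p : 'I_m) (a b : nat) : {set 'I_m} :=
  [set x | a <= pos p x < b].

Lemma mem_arc m (p x : 'I_m) a b : (x \in arc p a b) = (a <= pos p x < b).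
Proof. by rewrite inE. Qed.

Lemma pos_lt m (p x : 'I_m) : pos p x < m.
Proof. by rewrite ltn_mod; have := ltn_ord p; lia. Qed.

Lemma pos_self m (p : 'I_m) : pos p p = 0.
Proof. by rewrite /pos subnKC ?modnn // ltnW. Qed.

Lemma posE m (p x : 'I_m) : pos p x = if p <= x then x - p else x + (m - p).
Proof.
have hp := ltn_ord p; have hx := ltn_ord x; rewrite /pos; case: leqP => h.
  by rewrite (_ : x + (m - p) = x - p + m) ?modnDr ?modn_small //; lia.
by rewrite modn_small //; lia.
Qed.

Lemma pos_inj m (p : 'I_m) : injective (pos p).
Proof.
move=> x y h; apply: val_inj => /=; have hx := ltn_ord x; have hy := ltn_ord y.
by have hp := ltn_ord p; move: h; rewrite !posE; case: leqP => ?; case: leqP => ?; lia.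
Qed.

Lemma pos_eq0 m (p x : 'I_m) : pos p x = 0 -> x = p.
Proof. by rewrite -(pos_self p); apply: pos_inj. Qed.

Lemma pos_succ m (p x y : 'I_m) : val y = (val x).+1 %% m ->
  pos p y = if (pos p x).+1 < m then (pos p x).+1 else 0.
Proof.
move=> e; have lt := pos_lt p x.
have -> : pos p y = (pos p x).+1 %% m.
  by rewrite /pos [nat_of_ord y]e modnDml -[in RHS]addn1 modnDml addn1 addSn.
case: ltnP => h; first by rewrite modn_small.
by rewrite (_ : (pos p x).+1 = m) ?modnn; lia.
Qed.

Lemma ord_pred_succ m (x : 'I_m) : val x = (val (ord_pred x)).+1 %% m.
Proof. by rewrite -{1}[x]ord_predK. Qed.

Lemma pos_pred m (p x : 'I_m) :
  pos p (ord_pred x) = if pos p x == 0 then m.-1 else (pos p x).-1.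
Proof.
have lt := pos_lt p (ord_pred x); have := pos_succ p (ord_pred_succ x).
by case: ltnP => ? -> /=; lia.
Qed.

(** * Bundles: arcs, separation and convexity *)

Lemma cyc_adj_sym m : symmetric (@cyc_adj m).
Proof. by move=> x y; rewrite /cyc_adj orbC. Qed.

Lemma cyc_adj_pred m (x : 'I_m) : cyc_adj (ord_pred x) x.
Proof. by rewrite /cyc_adj -ord_pred_succ eqxx. Qed.

Lemma bundleP m (S : {set 'I_m}) :
  reflect {in S &, forall x y,
    connect [rel a b | [&& a \in S, b \in S & cyc_adj a b]] x y} (bundle S).
Proof.
apply: (iffP forallP) => [h x y xS yS | h x].
  by have /implyP/(_ xS)/forallP/(_ y)/implyP/(_ yS) := h x.
by apply/implyP => xS; apply/forallP => y; apply/implyP => yS; apply: h.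
Qed.

(** Stepping back from any member reaches the good at position [a], and both [x] and [y] are
    connected to that good. *)
Lemma bundle_arc m (p : 'I_m) a b : bundle (arc p a b).
Proof.
pose S := arc p a b; pose e := [rel x y | [&& x \in S, y \in S & cyc_adj x y]].
have esym : connect_sym e.
  by apply: sym_connect_sym => x y /=; rewrite cyc_adj_sym andbCA.
have start k x y : x \in arc p a b -> y \in arc p a b -> pos p x = a ->
    pos p y = a + k -> connect e x y.
  elim: k y => [|k IH] y xS yS xa yk.
    by rewrite (@pos_inj _ p x y) ?connect0 // xa yk addn0.
  have py : pos p (ord_pred y) = a + k by rewrite pos_pred yk addnS.
  have pS : ord_pred y \in arc p a b.
    by move: yS; rewrite !mem_arc yk py; lia.
  by apply: connect_trans (IH _ xS pS xa py) (connect1 _); rewrite /= pS yS cyc_adj_pred.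
have down k : forall x, pos p x = a + k -> x \in arc p a b ->
    exists2 z, z \in arc p a b & pos p z = a.
  elim: k => [|k IH] x xk xS; first by exists x; rewrite // xk addn0.
  have py : pos p (ord_pred x) = a + k by rewrite pos_pred xk addnS.
  by apply: IH (py) _; move: xS; rewrite !mem_arc xk py; lia.
apply/bundleP => x y xS yS.
have hx : pos p x = a + (pos p x - a) by move: xS; rewrite inE; lia.
have hy : pos p y = a + (pos p y - a) by move: yS; rewrite inE; lia.
have [z zS za] := down _ _ hx xS.
by apply: (@connect_trans _ _ z); [rewrite esym|]; apply: start zS _ za _; eassumption.
Qed.

(* Two goods outside a bundle cut the cycle into two arcs, and the bundle
   cannot meet both. *)
Lemma bundle_sep m (p : 'I_m) (S : {set 'I_m}) a b x y :
  bundle S -> a \notin S -> b \notin S -> x \in S -> y \in S ->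
  pos p a < pos p x < pos p b -> pos p a < pos p y < pos p b.
Proof.
move=> /bundleP bS aS bS' xS yS hx.
have /connectP[s] := bS _ _ xS yS; elim: s x xS hx => [|z s IH] x xS hx /=.
  by move=> _ ->.
case/andP=> /and3P[_ zS adj] hs yl; apply: IH hs yl => //.
have za : pos p z != pos p a by apply: contraNneq aS => /pos_inj <-.
have zb : pos p z != pos p b by apply: contraNneq bS' => /pos_inj <-.
have lb := pos_lt p b; have lz := pos_lt p z.
by case/orP: adj => /eqP /(pos_succ p); case: ltnP => ? e; lia.
Qed.

(** Otherwise [w] and [z] would separate [x] from [y]. So a bundle with a gap between two members
    must close up around the other side of the cycle. *)
Lemma bundle_gap m (p : 'I_m) (S : {set 'I_m}) x y w z :
  bundle S -> x \in S -> y \in S -> w \notin S -> pos p x <= pos p w <= pos p y ->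
  z \notin S -> pos p x <= pos p z <= pos p y.
Proof.
move=> bS xS yS wS /andP[xw wy] zS.
have ne a b : a \in S -> b \notin S -> pos p a != pos p b.
  by move=> aS bS'; apply: contraNneq bS' => /pos_inj <-.
have xw' := ne _ _ xS wS; have wy' := ne _ _ yS wS.
have xz := ne _ _ xS zS; have yz := ne _ _ yS zS.
apply/andP; split; rewrite leqNgt; apply/negP => h.
  by have /andP[] : pos p z < pos p y < pos p w; [apply: bundle_sep xS yS _ => // |]; lia.
by have /andP[] : pos p w < pos p x < pos p z; [apply: bundle_sep yS xS _ => // |]; lia.
Qed.

Definition convex m (p : 'I_m) (S : {set 'I_m}) : Prop :=
  forall x y z, x \in S -> z \in S -> pos p x <= pos p y <= pos p z -> y \in S.

Lemma bundle_convex m (p : 'I_m) (S : {set 'I_m}) :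
  bundle S -> p \notin S \/ ord_pred p \notin S -> convex p S.
Proof.
move=> bS pS x y z xS zS h; apply: contraT => yS.
have m0 := pos_lt p z; have hz : pos p (ord_pred p) = m.-1 by rewrite pos_pred pos_self.
(* A gap would force the missing end of the path, at position 0 or [m.-1], to lie between two
   members of [S]. *)
case: pS => pS; have := bundle_gap bS xS zS yS h pS.
  rewrite pos_self; case/andP; rewrite leqn0 => /eqP /pos_eq0 xp _.
  by rewrite -xp xS in pS.
rewrite hz => /andP[_ hm]; have e : pos p z = pos p (ord_pred p) by lia.
by rewrite -(pos_inj e) zS in pS.
Qed.

(** Walking back from [x] towards [y] must leave [S] somewhere. *)
Lemma exists_start m (S : {set 'I_m}) x y :
  x \in S -> y \notin S -> exists2 z, z \in S & ord_pred z \notin S.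
Proof.
move=> xS yS; move e: (pos y x) => k; elim: k x xS e => [|k IH] x xS e.
  by rewrite (pos_eq0 e) (negbTE yS) in xS.
case: (boolP (ord_pred x \in S)) => pS; last by exists x.
by apply: IH pS _; rewrite pos_pred e.
Qed.

(** * Packing consecutive arcs along the opened cycle *)

(* Bounds beyond [m] are harmless, and goods past the last arc stay free. *)
Fixpoint tiles m (p : 'I_m) (l : seq (pred {set 'I_m})) (q : nat) : Prop :=
  if l is Q :: l' then exists r, [/\ q <= r, Q (arc p q r) & tiles p l' r] else True.

Definition upward (T : finType) (Q : pred {set T}) : Prop :=
  forall S S' : {set T}, S \subset S' -> Q S -> Q S'.

Lemma arc_subset m (p : 'I_m) a b a' b' :
  a' <= a -> b <= b' -> arc p a b \subset arc p a' b'.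
Proof. by move=> ha hb; apply/subsetP => x; rewrite !mem_arc; lia. Qed.


Lemma tiles_nseq_mono m (p : 'I_m) Q k q q' :
  upward Q -> q' <= q -> tiles p (nseq k Q) q -> tiles p (nseq k Q) q'.
Proof.
case: k => //= k uQ le [r [qr Qr t]]; exists r; split=> //; first exact: leq_trans qr.
by apply: uQ Qr; apply: arc_subset.
Qed.

(** Greedy packing: the set that ends first comes first, and by convexity and disjointness all
    others lie wholly behind its end. Enlarging a set to an arc is harmless as [Q] is upward
    closed. *)
Lemma tiles_family m (p : 'I_m) (I : finType) (J : {set I}) (P : I -> {set 'I_m}) Q q :
  upward Q ->
  (forall j, j \in J -> P j != set0) ->
  (forall j, j \in J -> convex p (P j)) ->
  (forall j x, j \in J -> x \in P j -> q <= pos p x) ->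
  (forall i j x, i \in J -> j \in J -> x \in P i -> x \in P j -> i = j) ->
  (forall j, j \in J -> Q (P j)) ->
  tiles p (nseq #|J| Q) q.
Proof.
move=> uQ; move Ek : #|J| => k; elim: k J q Ek => [|k IH] J q Ek ne cv ge dj QP //=.
have [j0 j0J] : exists j, j \in J by apply/card_gt0P; rewrite Ek.
pose e j := \max_(x in P j) (pos p x).+1.
have [j /= jJ jmin] := @arg_minnP _ j0 (mem J) e j0J; rewrite /= in jJ.
have last i : i \in J -> exists2 x, x \in P i & e i = (pos p x).+1.
  move=> iJ; have [x xi ex] : {x | x \in P i & e i = (pos p x).+1}.
    by apply: eq_bigmax_cond; apply/card_gt0P/set0Pn/ne.
  by exists x.
have [x xj ex] := last _ jJ.
exists (e j); split.
- by rewrite ex; have := ge _ _ jJ xj; lia.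
- apply: uQ (QP _ jJ); apply/subsetP => y yj; rewrite mem_arc (ge _ _ jJ yj) /=.
  by apply: (@leq_bigmax_cond _ (mem (P j)) (fun y => (pos p y).+1)).
apply: (IH (J :\ j)) => [|i|i|i y|i i' y|i].
- by have := cardsD1 j J; rewrite (jJ : j \in J) Ek; lia.
- by case/setD1P=> _; apply: ne.
- by case/setD1P=> _; apply: cv.
(* If [P i] began before the end of [P j], then, ending no earlier, it would contain the last good
   [x] of [P j]. *)
- case/setD1P=> ij iJ yi; rewrite leqNgt; apply/negP => h.
  have [z zi ez] := last _ iJ; case/eqP: ij; apply: (dj _ _ x) => //.
  by apply: (cv _ iJ y x z) => //; have := jmin _ iJ; lia.
- by case/setD1P=> _ iJ /setD1P[_ i'J]; apply: dj.
- by case/setD1P=> _; apply: QP.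
Qed.

Lemma eq_in_map_nseq (I : eqType) (A : Type) (f : I -> A) (l : seq I) c :
  {in l, forall i, f i = c} -> map f l = nseq (size l) c.
Proof.
elim: l => //= i l IH fc; rewrite fc ?mem_head // IH // => j jl.
by apply: fc; rewrite inE jl orbT.
Qed.

(** * Serving agents of two types along a path *)

Section Agents.

Variables (m n : nat) (T : {set 'I_n}) (Q1 Q2 : pred {set 'I_m}).
Implicit Types (p : 'I_m) (l : seq 'I_n).

Definition sat (i : 'I_n) : pred {set 'I_m} := if i \in T then Q1 else Q2.

Definition satisfiable : Prop :=
  exists f : {ffun 'I_m -> 'I_n}, is_split f /\ forall i, sat i (part f i).

Hypotheses (up1 : upward Q1) (up2 : upward Q2).

Lemma sat_upward i : upward (sat i).
Proof. by rewrite /sat; case: ifP. Qed.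

(* Moving knife: the shortest prefix acceptable to one of the two types costs
   at most one piece of either tiling. *)
Lemma moving_knife p l q :
  tiles p (nseq (size l) Q1) q -> tiles p (nseq (size l) Q2) q ->
  exists2 l', perm_eq l' l & tiles p (map sat l') q.
Proof.
move Ek : (size l) => k; elim: k l q Ek => [|k IH] l q Ek t1 t2.
  by case: l Ek => // _; exists [::].
have [/allP all1|] := boolP (all (mem T) l).
  by exists l => //; rewrite (@eq_in_map_nseq _ _ _ _ Q1) ?Ek // /sat => i /all1 /= ->.
case/allPn => i2 i2l i2T.
have [/hasP[i1 i1l i1T]|] := boolP (has (mem T) l); last first.
  move/hasPn => all2; exists l => //.
  by rewrite (@eq_in_map_nseq _ _ _ _ Q2) ?Ek // /sat => i /all2 /negbTE /= ->.
have step i r : i \in l -> q <= r -> sat i (arc p q r) ->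
    tiles p (nseq k Q1) r -> tiles p (nseq k Q2) r ->
    exists2 l', perm_eq l' l & tiles p (map sat l') q.
  move=> il qr si u1 u2; have [|l' pl' tl'] := IH (rem i l) r _ u1 u2.
    by rewrite size_rem // Ek.
  exists (i :: l'); last by exists r.
  by rewrite perm_sym (perm_trans (perm_to_rem il)) // perm_cons perm_sym.
case: t1 => r1 [le1 Qr1 t1]; case: t2 => r2 [le2 Qr2 t2].
(* The knife stops at the smaller of [r1] and [r2]. The other tiling loses just its first piece,
   since its remaining pieces start beyond the knife. *)
have [le|/ltnW le] := leqP r1 r2.
  apply: (step i1 r1) => //; first by rewrite /sat (i1T : i1 \in T).
  exact: tiles_nseq_mono t2.
apply: (step i2 r2) => //; first by rewrite /sat (negbTE (i2T : i2 \notin T)).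
exact: tiles_nseq_mono t1.
Qed.

(** The bound [q <= a] carries the induction: it lets the goods before [r] go to the first agent
    without touching later arcs. *)
Lemma tiles_assign p l q : l != [::] -> uniq l -> tiles p (map sat l) q ->
  exists2 g : 'I_m -> 'I_n, forall x, g x \in l &
    forall i, i \in l -> exists a b,
      (forall x, q <= pos p x -> (g x == i) = (x \in arc p a b)) /\
      sat i (arc p a b) /\ q <= a.
Proof.
elim: l q => // i l IH q _ /andP[il ul] /= [r [qr sr tl]].
have [l0|l0] := eqVneq l [::].
  rewrite l0; exists (fun=> i) => [x|j]; first by rewrite mem_head.
  (* The last agent also takes the goods left free behind the last tile. *)
  rewrite inE => /eqP ->; exists q, (maxn r m); split=> [x qx|]; last split=> //.
    by rewrite mem_arc eqxx qx; have := pos_lt p x; lia.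
  by apply: sat_upward sr; apply: arc_subset => //; apply: leq_maxl.
have [g gl gP] := IH r l0 ul tl.
exists (fun x => if pos p x < r then i else g x) => [x|j].
  by rewrite inE; case: ifP; rewrite ?eqxx ?gl ?orbT.
rewrite inE => /predU1P[->|jl].
  exists q, r; split=> // x qx; rewrite mem_arc qx /=; case: ifP; rewrite ?eqxx // => _.
  by apply: contraNF il => /eqP <-; apply: gl.
have [a [b [gab [sab ra]]]] := gP _ jl; exists a, b; split=> [x qx|]; last first.
  by split=> //; apply: leq_trans ra.
case: ltnP => h; last exact: gab.
rewrite mem_arc (_ : a <= pos p x = false) /=; last lia.
by apply: contraNF il => /eqP ->.
Qed.

Lemma satisfiable_tiles p l : 0 < n -> perm_eq l (enum 'I_n) ->
  tiles p (map sat l) 0 -> satisfiable.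
Proof.
move=> n0 pl tl; have inl i : i \in l by rewrite (perm_mem pl) mem_enum.
have [||g _ gP] := @tiles_assign p l 0 _ _ tl.
- by apply/eqP => l0; have := inl (Ordinal n0); rewrite l0.
- by rewrite (perm_uniq pl) enum_uniq.
have gab i : exists a b, part [ffun x => g x] i = arc p a b /\ sat i (arc p a b).
  have [a [b [h [s _]]]] := gP _ (inl i); exists a, b; split=> //.
  by apply/setP => x; rewrite inE ffunE h.
exists [ffun x => g x]; split; last by move=> i; have [a [b [-> ?]]] := gab i.
by apply/forallP => i; have [a [b [-> _]]] := gab i; apply: bundle_arc.
Qed.

Lemma satisfiable_path p : 0 < n ->
  tiles p (nseq n Q1) 0 -> tiles p (nseq n Q2) 0 -> satisfiable.
Proof.
move=> n0; rewrite -{1 2}(size_enum_ord n) => t1 t2.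
by have [l pl tl] := moving_knife t1 t2; apply: satisfiable_tiles pl tl.
Qed.

Lemma satisfiable_path1 p i q : i \in T -> Q1 (arc p 0 q) ->
  tiles p (nseq n.-1 Q1) q -> tiles p (nseq n.-1 Q2) q -> satisfiable.
Proof.
move=> iT Qq; have ie : i \in enum 'I_n by rewrite mem_enum.
have -> : n.-1 = size (rem i (enum 'I_n)) by rewrite size_rem // size_enum_ord.
move=> t1 t2; have [l pl tl] := moving_knife t1 t2.
apply: (@satisfiable_tiles p (i :: l)); first by have := ltn_ord i; lia.
  by rewrite perm_sym (perm_trans (perm_to_rem ie)) // perm_cons perm_sym.
by exists q; rewrite /sat iT.
Qed.

End Agents.

(** * Permutations, exchange of types, initial arcs *)

(** List [A] before its complement and [B] before its complement, then match the two lists index by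
    index. *)
Lemma exists_inj_in (I : finType) (A B : {set I}) :
  #|A| <= #|B| -> exists2 h : I -> I, injective h & forall x, x \in A -> h x \in B.
Proof.
move=> leAB; pose w (C : {set I}) := enum C ++ enum (~: C).
have mw C x : x \in w C by rewrite mem_cat !mem_enum inE orbN.
have uw C : uniq (w C).
  rewrite cat_uniq !enum_uniq andbT /=; apply/hasPn => x.
  by rewrite !mem_enum inE.
have sw C : size (w C) = #|I| by rewrite size_cat -!cardE cardsC.
have lt x : index x (w A) < size (w B) by rewrite sw -(sw A) index_mem.
pose h x := nth x (w B) (index x (w A)).
have hinj : injective h.
  move=> x y; rewrite /h (set_nth_default y) // => /eqP; rewrite nth_uniq // => /eqP e.
  by rewrite -(nth_index x (mw A x)) e (set_nth_default y) ?nth_index // index_mem.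
exists h => // x xA; rewrite /h nth_cat.
have ltA : index x (w A) < #|B|.
  rewrite index_cat mem_enum xA; apply: leq_trans leAB.
  by rewrite cardE index_mem mem_enum.
by rewrite -cardE ltA -mem_enum mem_nth // -cardE.
Qed.

Lemma satisfiable_setC m n (T : {set 'I_n}) (Q1 Q2 : pred {set 'I_m}) :
  satisfiable (~: T) Q2 Q1 -> satisfiable T Q1 Q2.
Proof.
case=> f [sf fP]; exists f; split=> // i; have := fP i.
by rewrite /sat inE; case: (i \in T).
Qed.

Lemma convex_arc m (p : 'I_m) (S : {set 'I_m}) :
  convex p S -> p \in S -> exists q, S = arc p 0 q.
Proof.
move=> cS pS; pose e := \max_(x in S) (pos p x).+1; exists e.
have [x xS ex] : {x | x \in S & e = (pos p x).+1}.
  by apply: eq_bigmax_cond; apply/card_gt0P; exists p.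
apply/setP => y; rewrite mem_arc /=; apply/idP/idP => [yS|].
  by apply: (@leq_bigmax_cond _ (mem S) (fun y => (pos p y).+1)).
by rewrite ex ltnS => h; apply: (cS p y x) => //; rewrite pos_self.
Qed.

(** * Cuts of one split against the pieces of another *)

Section Splits.

Variables (m n : nat) (f g : {ffun 'I_m -> 'I_n}).
Hypotheses (split_f : is_split f) (split_g : is_split g).

Lemma mem_part (h : {ffun 'I_m -> 'I_n}) x i : (x \in part h i) = (h x == i).
Proof. by rewrite inE. Qed.

Lemma split_bundle (h : {ffun 'I_m -> 'I_n}) i : is_split h -> bundle (part h i).
Proof. by move/forallP. Qed.

Hypotheses (f_surj : forall i, part f i != set0) (g_surj : forall i, part g i != set0).

Section Satisfiable.

Variables (T : {set 'I_n}) (Q1 Q2 : pred {set 'I_m}).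
Hypotheses (up1 : upward Q1) (up2 : upward Q2).
Hypotheses (Qf : forall i, Q1 (part f i)) (Qg : forall i, Q2 (part g i)).

(** Opening the cycle at the start of [part f i] makes this piece an initial arc for [i0]; all
    pieces of [g] except the [j]-th lie intact behind it. *)
Lemma satisfiable_sub i0 i j :
  i0 \in T -> part f i \subset part g j -> satisfiable T Q1 Q2.
Proof.
move=> i0T sub.
have [fullA|/existsP[y yA]] := boolP [forall x, f x == i].
  (* A piece holding every good leaves no good for others, so [i0] is the only agent. *)
  exists f; split=> // k; have [x] := set0Pn _ (f_surj k).
  have [x0] := set0Pn _ (f_surj i0); rewrite !mem_part.
  rewrite (eqP (forallP fullA x)) (eqP (forallP fullA x0)) => /eqP e0 /eqP <-.
  by rewrite /sat e0 i0T.
have [x xA] := set0Pn _ (f_surj i).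
have [|p pA pA'] := @exists_start _ (part f i) x y xA; first by rewrite mem_part.
have cA : convex p (part f i) by apply: bundle_convex; [apply: split_bundle|right].
have [q Aq] := convex_arc cA pA.
have pB := subsetP sub _ pA; rewrite !mem_part in pA pB.
have out k z : k != i -> f z = k -> q <= pos p z.
  move=> ki fz; rewrite leqNgt; apply: contra ki => h.
  by rewrite -fz -mem_part Aq mem_arc.
apply: (@satisfiable_path1 _ _ _ _ _ up1 up2 p i0 q) => //; first by rewrite -Aq.
- have -> : n.-1 = #|[set~ i]| by rewrite cardsC1 card_ord.
  apply: (tiles_family (P := part f) up1) => [k _|k|k z|k k' z _ _|k _] //.
  + rewrite !inE => ki; apply: bundle_convex; first exact: split_bundle.
    by left; rewrite mem_part (eqP pA) eq_sym.
  + by rewrite !inE => ki /eqP; apply: out ki.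
  + by rewrite !mem_part => /eqP <- /eqP.
have -> : n.-1 = #|[set~ j]| by rewrite cardsC1 card_ord.
apply: (tiles_family (P := part g) up2) => [k _|k|k z|k k' z _ _|k _] //.
- rewrite !inE => kj; apply: bundle_convex; first exact: split_bundle.
  by left; rewrite mem_part (eqP pB) eq_sym.
- rewrite in_setC1 mem_part => kj /eqP gz; apply: out (erefl (f z)).
  apply: contra kj => fz; rewrite -gz -mem_part; apply: (subsetP sub).
  by rewrite mem_part.
- by rewrite !mem_part => /eqP <- /eqP.
Qed.

(** At a cut of [f] no piece of [f] is broken. [P] is meant as [g] with the piece crossing the cut
    reduced to its portion on one side. *)
Lemma satisfiable_cut (p : 'I_m) (P : 'I_n -> {set 'I_m}) :
  f p != f (ord_pred p) ->
  (forall j, P j != set0) -> (forall j, convex p (P j)) ->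
  (forall j, P j \subset part g j) -> (forall j, Q2 (P j)) ->
  satisfiable T Q1 Q2.
Proof.
move=> start ne cv sub QP; have n0 : 0 < n := leq_ltn_trans (leq0n _) (ltn_ord (f p)).
have en : n = #|[set: 'I_n]| by rewrite cardsT card_ord.
apply: (@satisfiable_path _ _ _ _ _ up1 up2 p) => //; rewrite {1}en.
- apply: (tiles_family (P := part f) up1) => [k _|k _|k z|k k' z _ _|k _] //.
    apply: bundle_convex; first exact: split_bundle.
    rewrite !mem_part; have [<-|] := eqVneq (f p) k; last by left.
    by right; rewrite eq_sym.
  by rewrite !mem_part => /eqP <- /eqP.
apply: (tiles_family (P := P) up2) => [k _|k _|k z|k k' z _ _|k _] //.
by move/(subsetP (sub k)); rewrite mem_part => /eqP <- /(subsetP (sub k')); rewrite mem_part => /eqP.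
Qed.

End Satisfiable.

(** A bundle ends only once: otherwise [p] and [p'], both outside it, would separate their
    predecessors, both inside it. *)
Lemma start_prev_inj (p p' : 'I_m) :
  f p != f (ord_pred p) -> f p' != f (ord_pred p') ->
  f (ord_pred p) = f (ord_pred p') -> p = p'.
Proof.
move=> sp sp' e; apply/eqP; apply: contraT => ne.
pose S := part f (f (ord_pred p)).
have bS : bundle S by apply: split_bundle.
have inS x : (x \in S) = (f x == f (ord_pred p)) by rewrite mem_part.
have m0 := pos_lt p p'.
have p'0 : pos p p' != 0 by apply: contraNneq ne => /pos_eq0 ->.
have q'0 : pos p (ord_pred p') != 0.
  by apply: contraNneq sp => /pos_eq0 {1}<-; rewrite -e.
have pS : p \notin S by rewrite inS.
have pS' : p' \notin S by rewrite inS e.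
have qS : ord_pred p \in S by rewrite inS.
have qS' : ord_pred p' \in S by rewrite inS e.
have := @bundle_sep _ p _ _ _ _ _ bS pS pS' qS' qS; rewrite !pos_pred pos_self (negbTE p'0) /=.
rewrite pos_pred (negbTE p'0) in q'0.
by move=> h; have /h /andP[] : 0 < (pos p p').-1 < pos p p'; clear split_g; lia.
Qed.

Hypothesis f_notin_g : forall i j, ~~ (part f i \subset part g j).
Hypothesis g_notin_f : forall i j, ~~ (part g j \subset part f i).

Section Start.

Variable p : 'I_m.
Hypothesis start : f p != f (ord_pred p).

Let A := part f (f p).
Let A' := part f (f (ord_pred p)).
Let B := part g (g p).

Let cA : convex p A.
Proof.
apply: bundle_convex; first exact: split_bundle.
by right; rewrite mem_part eq_sym.
Qed.

Let cA' : convex p A'.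
Proof. by apply: bundle_convex; [apply: split_bundle|left; rewrite mem_part]. Qed.

Let pA : p \in A. Proof. by rewrite mem_part. Qed.
Let pB : p \in B. Proof. by rewrite mem_part. Qed.
Let lA' : ord_pred p \in A'. Proof. by rewrite mem_part. Qed.

Let A_before x y : x \in A -> y \notin A -> pos p x < pos p y.
Proof.
move=> xA; rewrite ltnNge; apply: contra => h.
by apply: (cA pA xA); rewrite pos_self.
Qed.

Let A'_after x y : x \in A' -> y \notin A' -> pos p y < pos p x.
Proof.
move=> xA; rewrite ltnNge; apply: contra => h; apply: (cA' xA lA').
by rewrite h pos_pred pos_self /=; have := pos_lt p y; lia.
Qed.

Let AA' x : x \in A' -> x \notin A.
Proof. by rewrite !mem_part => /eqP ->; rewrite eq_sym. Qed.

(** The cut falls strictly inside [B]: if [B] started at [p] as [A] does, one of the two would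
    contain the other. *)
Lemma start_prev_part : g (ord_pred p) = g p.
Proof.
apply/eqP; rewrite -mem_part; apply: contraT => lB.
have cB : convex p B by apply: bundle_convex; [apply: split_bundle|right].
have [z zA zB] := subsetPn (f_notin_g (f p) (g p)).
have [z' zB' zA'] := subsetPn (g_notin_f (f p) (g p)).
case/negP: zB; apply: (cB p z z' pB zB'); rewrite pos_self /=.
exact: ltnW (A_before zA zA').
Qed.

Let lB : ord_pred p \in B. Proof. by rewrite mem_part start_prev_part. Qed.

(** [A] opens the path, [A'] closes it, and each has a good outside [B]. These two goods would
    separate a member of [B] beyond [A] and [A'] from [ord_pred p]. *)
Lemma start_part_subset : B \subset A :|: A'.
Proof.
apply/subsetP => y yB; rewrite inE; apply: contraT; rewrite negb_or => /andP[yA yA'].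
have [z zA zB] := subsetPn (f_notin_g (f p) (g p)).
have [z' zA' zB'] := subsetPn (f_notin_g (f (ord_pred p)) (g p)).
have := @bundle_sep _ p B z z' y (ord_pred p) (split_bundle _ split_g) zB zB' yB lB.
rewrite A_before // A'_after // => /(_ isT) /andP[_]; rewrite pos_pred pos_self /=.
by move=> h; have h' := pos_lt p z'; clear -h h'; lia.
Qed.

(** A gap would confine all goods outside [B] to the span of [A], but [A'] has such a good. *)
Lemma start_convex_left : convex p (B :&: A).
Proof.
move=> x y z; rewrite !in_setI => /andP[xB xA] /andP[zB zA] h.
rewrite (cA xA zA h) andbT; apply: contraT => yB.
have [w wA wB] := subsetPn (f_notin_g (f (ord_pred p)) (g p)).
have := bundle_gap (split_bundle _ split_g) xB zB yB h wB.
by move/andP=> [_]; rewrite leqNgt A_before // AA'.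
Qed.

Lemma start_convex_right : convex p (B :&: A').
Proof.
move=> x y z; rewrite !in_setI => /andP[xB xA] /andP[zB zA] h.
rewrite (cA' xA zA h) andbT; apply: contraT => yB.
have [w wA wB] := subsetPn (f_notin_g (f p) (g p)).
have := bundle_gap (split_bundle _ split_g) xB zB yB h wB.
by move/andP=> []; rewrite leqNgt A_before // AA'.
Qed.

(** Different cuts of [f] fall in different pieces of [g]: a good of [A] outside [B] and one of the
    piece starting at [p'] outside [B] separate [p] from [p']. *)
Lemma start_part_inj (p' : 'I_m) : f p' != f (ord_pred p') -> f p' != f p -> g p' != g p.
Proof.
move=> sp' ne; rewrite -mem_part; apply/negP => p'B.
have [z zA zB] := subsetPn (f_notin_g (f p) (g p)).
have [z' zA' zB'] := subsetPn (f_notin_g (f p') (g p)).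
have p'A : p' \notin A by rewrite mem_part.
have c' : convex p (part f (f p')).
  by apply: bundle_convex; [apply: split_bundle|left; rewrite mem_part eq_sym].
have lt : pos p p' < pos p z'.
  have z'p' : pos p z' != pos p p' by apply: contraNneq zB' => /pos_inj ->.
  rewrite ltnNge; apply/negP => h; case/eqP: sp'; apply/esym/eqP; rewrite -mem_part.
  have p'm : p' \in part f (f p') by rewrite mem_part.
  have p'0 : pos p p' != 0 by apply: contraNneq ne => /pos_eq0 ->.
  apply: (c' z' _ p' zA' p'm); rewrite pos_pred (negbTE p'0).
  by clear -h p'0 z'p'; lia.
have := @bundle_sep _ p B z z' p' p (split_bundle _ split_g) zB zB' p'B pB.
by rewrite lt A_before // pos_self => /(_ isT).
Qed.

End Start.

End Splits.

Local Open Scope ring_scope.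

(** * Utilities and maximin shares *)

Section Utilities.

Variables (R : realFieldType) (m : nat).
Implicit Types (u v : 'I_m -> R) (S : {set 'I_m}).

Lemma util_disjoint u S S1 S2 : (forall x, 0 <= u x) ->
  S1 \subset S -> S2 \subset S -> (forall x, x \in S1 -> x \notin S2) ->
  util u S1 + util u S2 <= util u S.
Proof.
move=> u0 s1 s2 dj; rewrite /util [leRHS](big_setID S1) /= (setIidPr s1) lerD2l.
rewrite [leRHS](big_setID S2) /= (_ : (S :\: S1) :&: S2 = S2).
  by rewrite lerDl sumr_ge0.
apply/setIidPr/subsetP => x x2; rewrite inE (subsetP s2) // andbT.
by apply: contraL x2; apply: dj.
Qed.

Lemma util_cover u S S1 S2 : (forall x, 0 <= u x) ->
  S \subset S1 :|: S2 -> util u S <= util u (S :&: S1) + util u (S :&: S2).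
Proof.
move=> u0 sub; rewrite [leLHS](big_setID S1) /= lerD2l.
have /(setIidPr) <- : S :\: S1 \subset S :&: S2.
  apply/subsetP => x; rewrite !inE => /andP[x1 xS].
  by have := subsetP sub _ xS; rewrite inE (negbTE x1) xS.
by rewrite [leRHS](big_setID (S :\: S1)) /= lerDl sumr_ge0.
Qed.

Lemma util_upward u c : (forall x, 0 <= u x) -> upward (fun S => c <= util u S).
Proof.
move=> u0 S S' sub h; apply: le_trans h _.
by rewrite [leRHS](big_setID S) /= (setIidPr sub) lerDl sumr_ge0.
Qed.

Lemma mms_split n u : (0 < n)%N -> (forall x, 0 <= u x) ->
  (* The trivial split [f0] shows that splits exist; as their values are non-negative, the default 0
     of the maximum is harmless and the maximum is attained. *)
  exists f : {ffun 'I_m -> 'I_n}, is_split f /\ forall i, mms n u <= util u (part f i).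
Proof.
move=> n0 u0; pose f0 : {ffun 'I_m -> 'I_n} := [ffun=> Ordinal n0].
have f0P : is_split f0.
  apply/forallP => i; apply/bundleP => x y.
  rewrite !inE !ffunE => /eqP <- _.
  have -> : connect [rel a b | [&& a \in part f0 (Ordinal n0), b \in part f0 (Ordinal n0) & cyc_adj a b]] x y
    = connect [rel a b | [&& a \in arc x 0 m, b \in arc x 0 m & cyc_adj a b]] x y.
    apply: eq_connect => a b /=.
    by rewrite !inE !ffunE !eqxx !pos_lt.
  by have /bundleP := bundle_arc x 0 m; apply; rewrite mem_arc pos_lt.
have min0 (f : {ffun 'I_m -> 'I_n}) : is_split f -> 0 <= split_min u f.
  by move=> _; apply: le_bigmin => [|i _]; apply: sumr_ge0.
have [f fP ->] : {f : {ffun 'I_m -> 'I_n} | is_split f & mms n u = split_min u f}.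
  by have [f fP e] := eq_bigmax f0 _ _ f0P min0; exists f.
by exists f; split=> // i; apply: bigmin_le.
Qed.

End Utilities.

(** * Counting acceptable pieces *)

(** Permute the pieces of [f] so that the agents outside [T] receive pieces satisfying [Q2]. *)
Lemma satisfiable_perm m n (T : {set 'I_n}) (Q1 Q2 : pred {set 'I_m})
    (f : {ffun 'I_m -> 'I_n}) :
  is_split f -> (forall i, Q1 (part f i)) ->
  (#|~: T| <= #|[set i | Q2 (part f i)]|)%N -> satisfiable T Q1 Q2.
Proof.
move=> sf Qf /exists_inj_in[h hinj hP].
have ph i : part [ffun x => invF hinj (f x)] i = part f (h i).
  by apply/setP => x; rewrite !inE ffunE (can2_eq (f_invF hinj) (invF_f hinj)).
exists [ffun x => invF hinj (f x)]; split.
  by apply/forallP => i; rewrite ph; apply: split_bundle.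
move=> i; rewrite ph /sat; case: ifP => // iT.
by have := hP i; rewrite !inE iT; apply.
Qed.

Section TwoTypes.

Variables (R : realFieldType) (m n : nat) (v : 'I_m -> R) (M : R).
Variables (f g : {ffun 'I_m -> 'I_n}) (T : {set 'I_n}) (Q1 : pred {set 'I_m}).
Hypotheses (v_ge0 : forall x, 0 <= v x) (M_gt0 : 0 < M) (up1 : upward Q1).
Hypotheses (split_f : is_split f) (split_g : is_split g).
Hypothesis (f_surj : forall i, part f i != set0).
Hypotheses (Qf : forall i, Q1 (part f i)) (Mg : forall j, M <= util v (part g j)).

Let Q2 : pred {set 'I_m} := fun S => 3 / 4 * M <= util v S.

Let up2 : upward Q2. Proof. exact: util_upward. Qed.

Let Qg j : Q2 (part g j). Proof. by rewrite /Q2; move: (Mg j) M_gt0; lra. Qed.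

Let Q2_neq0 S : Q2 S -> S != set0.
Proof. by apply: contraTneq => ->; rewrite /Q2 /util big_set0 -ltNge; move: M_gt0; lra. Qed.

Let g_surj j : part g j != set0. Proof. exact: Q2_neq0. Qed.

Lemma satisfiable_two_types :
  T != set0 -> ~: T != set0 -> (#|~: T| <= #|T|)%N -> satisfiable T Q1 Q2.
Proof.
move=> /set0Pn[i1 i1T] /set0Pn[i2 i2T] leT.
have [/existsP[i /existsP[j sub]]|nAB] := boolP [exists i, exists j, part f i \subset part g j].
  exact: (satisfiable_sub split_f split_g f_surj g_surj up1 up2 Qf Qg i1T sub).
have [/existsP[i /existsP[j sub]]|nBA] := boolP [exists i, exists j, part g j \subset part f i].
  apply: satisfiable_setC.
  exact: (satisfiable_sub split_g split_f g_surj f_surj up2 up1 Qg Qf i2T sub).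
have f_notin_g i j : ~~ (part f i \subset part g j).
  by apply: contra nAB => h; apply/existsP; exists i; apply/existsP; exists j.
have g_notin_f i j : ~~ (part g j \subset part f i).
  by apply: contra nBA => h; apply/existsP; exists i; apply/existsP; exists j.
have /fin_all_exists[s sP] i : exists p, f p = i /\ f p != f (ord_pred p).
  have [x xi] := set0Pn _ (f_surj i).
  have [y _ yi] := subsetPn (g_notin_f i i).
  have [p pi pi'] := exists_start xi yi; exists p.
  by rewrite !mem_part in pi pi'; rewrite (eqP pi) eq_sym.
have fs i : f (s i) = i by case: (sP i).
have ss i : f (s i) != f (ord_pred (s i)) by case: (sP i).
(* [s i] starts piece [i], [prv i] is the piece before it, and [B i] straddles the cut between them;
   [X i] and [Y i] are the values of [B i] after and before this cut. *)
pose prv i := f (ord_pred (s i)); pose B i := part g (g (s i)).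
pose X i := util v (B i :&: part f i); pose Y i := util v (B i :&: part f (prv i)).
have cut i S : Q2 (B i :&: S) -> convex (s i) (B i :&: S) -> satisfiable T Q1 Q2.
  move=> QS cS; pose P j := if j == g (s i) then B i :&: S else part g j.
  have QP j : Q2 (P j) by rewrite /P; case: ifP.
  have start := ss i; apply: (satisfiable_cut split_f f_surj T up1 up2 Qf start (P:=P)) => // j.
  - exact: Q2_neq0.
  - rewrite /P; case: eqVneq => // jg; apply: bundle_convex; first exact: split_bundle.
    by left; rewrite mem_part eq_sym.
  - by rewrite /P; case: eqVneq => // ->; apply: subsetIl.
have [/existsP[i QX]|noX] := boolP [exists i, Q2 (B i :&: part f i)].
  apply: cut QX _.
  by have := start_convex_left split_f split_g f_notin_g (ss i); rewrite fs.
have [/existsP[i QY]|noY] := boolP [exists i, Q2 (B i :&: part f (prv i))].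
  exact: cut QY (start_convex_right split_f split_g f_notin_g (ss i)).
have ltX i : X i < 3 / 4 * M.
  by rewrite ltNge; apply: contra noX => h; apply/existsP; exists i.
have ltY i : Y i < 3 / 4 * M.
  by rewrite ltNge; apply: contra noY => h; apply/existsP; exists i.
have XY i : M <= X i + Y i.
  apply: le_trans (Mg (g (s i))) _; apply: util_cover => //.
  by have := start_part_subset split_f split_g f_notin_g g_notin_f (ss i); rewrite fs.
have prv_inj : injective prv.
  move=> i k e; rewrite -(fs i) -(fs k); congr (f _).
  exact: (start_prev_inj split_f (ss i) (ss k) e).
have prv_neq i : prv i != i by have := ss i; rewrite fs eq_sym.
(* Piece [prv k] meets [B (prv k)] at its start and [B k] at its end, and these are different pieces
   of [g]. *)
have val_prv k : X (prv k) + Y k <= util v (part f (prv k)).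
  apply: util_disjoint; rewrite ?subsetIr // => x; rewrite !in_setI => /andP[xB _].
  rewrite negb_and; apply/orP; left; apply: contraL xB => xB.
  rewrite mem_part; move: xB; rewrite mem_part => /eqP ->.
  apply: (start_part_inj split_f split_g f_notin_g (ss (prv k)) (ss k)).
  by rewrite !fs eq_sym.
pose G := [set i | Q2 (part f i)].
have bad k : prv k \notin G -> prv (prv k) \in G.
  rewrite !inE -ltNge => h; rewrite /Q2.
  (* The two pieces are together worth at least [X (prv k) + Y (prv k)], hence [M], plus [Y k] and
     [X (prv (prv k))], each above [M / 4]. *)
  have := val_prv k; have := val_prv (prv k).
  have := XY k; have := XY (prv k); have := XY (prv (prv k)).
  have := ltX k; have := ltY (prv (prv k)); lra.
(* [prv] is a permutation sending bad pieces into [G], so at least half of the pieces are in [G]. *)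
have disj : prv @: (~: G) \subset G.
  apply/subsetP => _ /imsetP[i iG ->].
  have /codomP[k ik] : i \in codom prv by apply: injF_onto.
  by rewrite inE ik in iG; rewrite ik; apply: bad.
apply: satisfiable_perm split_f Qf _; rewrite -/G.
have leG := subset_leq_card disj; rewrite card_imset // in leG.
have := cardsC G; rewrite -(cardsC T) => e; clear -leT leG e; lia.
Qed.

End TwoTypes.

(** * From thresholds to maximin shares *)

Lemma satisfiable_mms (R : realFieldType) m n (T : {set 'I_n}) (u1 u2 : 'I_m -> R) :
  (0 < n)%N -> (forall x, 0 <= u1 x) -> (forall x, 0 <= u2 x) ->
  satisfiable T (fun S => 3 / 4 * mms n u1 <= util u1 S)
                (fun S => 3 / 4 * mms n u2 <= util u2 S).
Proof.
move=> n_gt0; wlog leT : T u1 u2 / (#|~: T| <= #|T|)%N => [wlogT|] u1_ge0 u2_ge0.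
  have [le|/ltnW le] := leqP #|~: T| #|T|; first exact: wlogT.
  by apply: satisfiable_setC; apply: wlogT; rewrite ?setCK.
have [f [sf fP]] := mms_split n_gt0 u1_ge0.
have [g [sg gP]] := mms_split n_gt0 u2_ge0.
have mms_ge0 (u : 'I_m -> R) : 0 <= mms n u by apply: bigmax_ge_id.
have fP' i : 3 / 4 * mms n u1 <= util u1 (part f i).
  by have := fP i; have := mms_ge0 u1; lra.
have gP' i : 3 / 4 * mms n u2 <= util u2 (part g i).
  by have := gP i; have := mms_ge0 u2; lra.
(* A type with share 0 accepts any piece, so an optimal split for the other type works. Positive
   shares make all pieces nonempty. *)
have [M1|M1] := eqVneq (mms n u1) 0.
  exists g; split=> // i; rewrite /sat; case: ifP => // _.
  by rewrite M1 mulr0; apply: sumr_ge0.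
have [M2|M2] := eqVneq (mms n u2) 0.
  exists f; split=> // i; rewrite /sat; case: ifP => // _.
  by rewrite M2 mulr0; apply: sumr_ge0.
have [T0|T0] := eqVneq T set0.
  by exists g; split=> // i; rewrite /sat T0 inE; apply: gP'.
have [CT0|CT0] := eqVneq (~: T) set0.
  by exists f; split=> // i; rewrite /sat -[T]setCK CT0 !inE; apply: fP'.
have f_surj i : part f i != set0.
  apply: contraTneq (fP i) => ->.
  by rewrite /util big_set0 -ltNge lt_def M1 mms_ge0.
have M2_gt0 : 0 < mms n u2 by rewrite lt_def M2 mms_ge0.
have up1 := @util_upward R m u1 (3 / 4 * mms n u1) u1_ge0.
exact: (satisfiable_two_types u2_ge0 M2_gt0 up1 sf sg f_surj fP' gP T0 CT0 leT).
Qed.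

Theorem theorem4p8 (R : realFieldType) (m n : nat) (U : 'I_n -> 'I_m -> R) :
  (0 < n)%N ->
  (forall (i : 'I_n) (g : 'I_m), 0 <= U i g) ->
  (exists u1 u2 : 'I_m -> R, forall i : 'I_n, U i = u1 \/ U i = u2) ->
  exists f : {ffun 'I_m -> 'I_n}, sufficient U (3 / 4) f.
Proof.
move=> n_gt0 U_ge0 [u1 [u2 U12]].
(* [u1] and [u2] come without a sign condition; utilities of actual agents are non-negative. A type
   with no agent is represented by [i0], vacuously. *)
have [i1 [i2 [T UT]]] : exists i1 i2 (T : {set 'I_n}),
    forall i, U i = if i \in T then U i1 else U i2.
  have /fin_all_exists[b bP] i : exists b : bool, U i = if b then u1 else u2.
    by case: (U12 i) => ->; [exists true | exists false].
  pose i0 := Ordinal n_gt0.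
  have rep c : exists j, forall i, b i = c -> U i = U j.
    have [/existsP[j /eqP bj]|/existsPn none] := boolP [exists j, b j == c].
      by exists j => i bi; rewrite !bP bi bj.
    by exists i0 => i /eqP; rewrite (negbTE (none i)).
  have [i1 h1] := rep true; have [i2 h2] := rep false.
  exists i1, i2, [set i | b i] => i; rewrite inE.
  by case: ifP => [/h1|/h2].
have [f [sf fP]] := satisfiable_mms T n_gt0 (U_ge0 i1) (U_ge0 i2).
exists f; split=> // i; have := fP i; rewrite /sat (UT i).
by case: ifP.
Qed.
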